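(* Let $G$ be an Abelian group, let $X$ be a $\wedge$-closed subset of a lattice $L$ (regarded as a semilattice), $\iota:X\hookrightarrow L$ the inclusion map and $L_X$ the sublattice of $L$ generated by $\iota[X]$. Each modular function $f\in\mathfrak F_m(X,G)$ admits a unique extension $g\in\mathfrak F_m(L_X,G)$. Moreover, if $T$ is the canonical representation of $f$, then $g$ takes the form $$g\Big(\bigvee_{1\le n\le N}\iota(x_n)\Big)=T([x_1,\ldots,x_N]),\qquad x_1,\ldots,x_N\in X .$$
   Context: A semilattice is a commutative idempotent semigroup $(X,\wedge)$, ordered by $x\le y$ iff $x=x\wedge y$. For $x_n\in X$, $\bigvee_n x_n$ denotes the least upper bound computed in $X$ (when it exists), while $\bigvee_n\iota(x_n)$ denotes the least upper bound computed in $L$. A lattice is said to be generated by a $\wedge$-closed subset $X$ if each of its elements is a finite supremum (taken in the lattice) of elements of $X$. $[N]=\{1,\ldots,N\}$, and $\nu(b)=(-1)^{1+|b|}$ for a finite set $b$. For a semilattice $Y$, $f:Y\to G$ is modular, $f\in\mathfrak F_m(Y,G)$, if $f\big(\bigvee_{1\le n\le N}y_n\big)=\sum_{\emptyset\ne b\subseteq[N]}\nu(b)f\big(\bigwedge_{n\in b}y_n\big)$ for all $N\ge1$ and $y_1,\ldots,y_N\in Y$ whose least upper bound exists in $Y$. Canonical space: on finite sequences (including the empty one) of elements of $X$ put $\langle x_1,\ldots,x_N\rangle\le\langle z_1,\ldots,z_M\rangle$ if for every $n\in[N]$ there is $m\in[M]$ with $x_n\le z_m$. $\Xi$ is the quotient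 of the set of finite sequences by the equivalence relation ($\le$ and $\ge$) induced by this preorder; $[x_1,\ldots,x_N]$ is the class of $\langle x_1,\ldots,x_N\rangle$. The canonical representation of $f:X\to G$ is the (well-defined) function $T:\Xi\to G$, $T([x_1,\ldots,x_N])=\sum_{\emptyset\ne b\subseteq[N]}\nu(b)f\big(\bigwedge_{n\in b}x_n\big)$.
   Formalization: The lattice L is assumed distributive; for arbitrary lattices the claim fails (L = M3 = {0,a,b,c,1}, X = {0,a,b,c}, G = Z, f(a) = 1 and f = 0 elsewhere: f is modular on X but has no modular extension). *)

(* Defs.v *)
From HB Require Import structures.
From mathcomp Require Import all_boot all_order all_algebra.
From mathcomp Require Import boolp classical_sets.

Set Implicit Arguments.
Unset Strict Implicit.
Unset Printing Implicit Defensive.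

Import Order.TTheory GRing.Theory.

Local Open Scope classical_set_scope.
Local Open Scope order_scope.

Definition nu (I : finType) (b : {set I}) : int := ((-1) ^+ (1 + #|b|))%R.

Section InclusionExclusion.
Context (d : Order.disp_t) (Y : meetSemilatticeType d) (G : zmodType).
Implicit Types (f : Y -> G) (I J : finType).

(* [f_meet f y b] is f of the meet of the y_n, n in b.  A semilattice need
   not have a top element, hence the iterated meet starts from some y_n0 with
   n0 in b (harmless by idempotence); 0 is a junk value for b empty. *)
Definition f_meet f I (y : I -> Y) (b : {set I}) : G :=
  if [pick n in b] is Some n0 then f (\big[Order.meet/y n0]_(n in b) y n)
  else 0%R.

Definition incl_excl f I (y : I -> Y) : G :=
  (\sum_(b : {set I} | b != finset.set0) f_meet f y b *~ nu b)%R.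

(* The least upper bound is taken in Y; empty families are excluded. *)
Definition modular f : Prop :=
  forall (N : nat) (y : 'I_N -> Y) (u : Y), (0 < N)%N ->
    supremums (range y) u -> f u = incl_excl f y.

Lemma le_bigmeet I (y : I -> Y) (b : {set I}) (n0 : I) (z : Y) : n0 \in b ->
  (z <= \big[Order.meet/y n0]_(n in b) y n) = [forall (n | n \in b), z <= y n].
Proof.
move=> n0b; rewrite (big_morph (fun m => z <= m) (id1 := z <= y n0) (op1 := andb)).
  apply/idP/forall_inP => [|zy].
    move=> h n nb; move: h; rewrite -big_filter.
    have : n \in [seq i <- index_enum I | i \in b].
      by rewrite mem_filter nb mem_index_enum.
    elim: [seq i <- _ | _] => //= a l IHl; rewrite inE big_cons.
    by case/predU1P => [->|/IHl hl] /andP[// _ /hl].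
  by rewrite zy// big1.
by move=> u v; rewrite lexI.
by [].
Qed.

Lemma f_meet_congr f I J (y : I -> Y) (w : J -> Y) (b : {set I}) (c : {set J}) :
  b != finset.set0 -> c != finset.set0 ->
  (forall z, [forall (n | n \in b), z <= y n] = [forall (n | n \in c), z <= w n]) ->
  f_meet f y b = f_meet f w c.
Proof.
move=> /finset.set0Pn[i ib] /finset.set0Pn[j jc] bc; rewrite /f_meet.
case: pickP => [i0 i0b|/(_ i)]; last by rewrite ib.
case: pickP => [j0 j0c|/(_ j)]; last by rewrite jc.
congr f; apply/le_anti/andP; split.
  by rewrite le_bigmeet// -bc -(le_bigmeet y _ i0b).
by rewrite le_bigmeet// bc -(le_bigmeet w _ j0c).
Qed.

(* The part of [incl_excl f y] carried by the subsets of A. *)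
Definition incl_excl_in f I (y : I -> Y) (A : {set I}) : G :=
  (\sum_(b : {set I} | (b != finset.set0) && (b \subset A))
    f_meet f y b *~ nu b)%R.

Lemma incl_excl_inD1 f I (y : I -> Y) (A : {set I}) (i j : I) :
  i \in A -> i != j -> y j <= y i ->
  incl_excl_in f y A = incl_excl_in f y (A :\ j)%SET.
Proof.
move=> iA ij yji; rewrite /incl_excl_in (bigID (fun b : {set I} => j \in b)) /=.
rewrite [X in (X + _)%R](_ : _ = 0%R).
  rewrite GRing.add0r; apply: eq_bigl => b; rewrite subsetD1.
  by rewrite -andbA.
rewrite (bigID (fun b : {set I} => i \in b)) /=.
apply/eqP; rewrite GRing.addr_eq0 -GRing.sumrN; apply/eqP.
rewrite (reindex_onto (fun b => i |: b)%SET (fun b => b :\ i)%SET) /=; last first.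
  by move=> b /andP[_ ib]; rewrite finset.setD1K.
apply: eq_big => [b|b].
  rewrite !finset.inE eqxx (eq_sym j) (negPf ij) /= andbT.
  rewrite finset.subUset finset.sub1set iA /=.
  have -> : ((i |: b) :\ i == b)%SET = (i \notin b).
    apply/eqP/idP => [<-|ib]; first by rewrite !finset.inE eqxx.
    by rewrite finset.setU1K.
  have -> : (i |: b)%SET != finset.set0.
    by apply/finset.set0Pn; exists i; rewrite !finset.inE eqxx.
  rewrite /=; case jb : (j \in b); rewrite ?andbF //= !andbT.
  have -> // : b != finset.set0 by apply/finset.set0Pn; exists j.
move=> /andP[/andP[/andP[/andP[_ _]]]]; rewrite !finset.inE (eq_sym j) (negPf ij) /=.
move=> jb _ /eqP bE.
have ib : i \notin b by rewrite -bE !finset.inE eqxx.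
have -> : nu (i |: b)%SET = (- nu b)%R.
  by rewrite /nu finset.cardsU1 ib [LHS]GRing.exprS GRing.mulN1r.
rewrite mulrNz; congr (- (_ *~ _))%R; apply: f_meet_congr.
- by apply/finset.set0Pn; exists i; rewrite !finset.inE eqxx.
- by apply/finset.set0Pn; exists j.
move=> z; apply/forall_inP/forall_inP => h n nb.
  by apply: h; rewrite !finset.inE nb orbT.
move: nb; rewrite !finset.inE => /predU1P[->|/h//].
by rewrite (le_trans (h j jb)).
Qed.

Lemma incl_excl_in_sub f I (y : I -> Y) (A B : {set I}) :
  A \subset B -> (forall j, j \in B -> exists2 i, i \in A & y j <= y i) ->
  incl_excl_in f y B = incl_excl_in f y A.
Proof.
move: {2}#|(B :\: A)%SET| (leqnn #|(B :\: A)%SET|) => k.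
elim: k B => [|k IHk] B; move=> kB AB yAB.
  congr incl_excl_in; apply/eqP; rewrite finset.eqEsubset AB andbT.
  by rewrite -finset.setD_eq0 -finset.cards_eq0 -leqn0.
have [/eqP|/finset.set0Pn[j]] := eqVneq (B :\: A)%SET finset.set0.
  rewrite finset.setD_eq0 => BA; congr incl_excl_in; apply/eqP.
  by rewrite finset.eqEsubset AB BA.
rewrite finset.inE => /andP[jA jB]; have [i iA yji] := yAB j jB.
have ij : i != j by apply: contraNneq jA => <-.
rewrite (incl_excl_inD1 f (fintype.subsetP AB _ iA) ij yji); apply: IHk.
- rewrite -ltnS (leq_trans _ kB)//; apply: proper_card.
  apply/properP; split.
    by apply/fintype.subsetP => n; rewrite !finset.inE => /and3P[-> _ ->].
  by exists j; rewrite !finset.inE ?jA ?jB ?eqxx ?andbF.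
- by rewrite finset.subsetD1 AB.
- by move=> n; rewrite finset.inE => /andP[_ /yAB].
Qed.

Lemma incl_excl_in_imset f I J (h : I -> J) (y : J -> Y) : injective h ->
  incl_excl_in f y [set h i | i in [set: I]]%SET = incl_excl f (y \o h).
Proof.
move=> hI; rewrite /incl_excl_in /incl_excl.
have hK (b : {set I}) : (h @^-1: (h @: b))%SET = b.
  by apply/finset.setP => i; rewrite finset.inE finset.mem_imset.
have h0 (b : {set I}) : ((h @: b)%SET != finset.set0) = (b != finset.set0).
  by rewrite finset.imset_eq0.
rewrite (reindex_onto (fun b : {set I} => h @: b)%SET (fun c => h @^-1: c)%SET) /=.
  apply: eq_big => [b|b].
    by rewrite hK eqxx andbT h0 finset.imsetS ?finset.subsetT ?andbT.
  move=> /andP[/andP[b0 _] _]; rewrite /nu finset.card_imset//.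
  congr (_ *~ _)%R; apply: f_meet_congr => //; first by rewrite -h0.
  move=> z; apply/forall_inP/forall_inP => zy n.
    by move=> nb; apply: zy; rewrite finset.mem_imset.
  by move=> /finset.imsetP[i ib ->]; exact: zy.
move=> c /andP[_ /fintype.subsetP cT]; apply/finset.setP => j; apply/finset.imsetP/idP.
  by move=> [i]; rewrite finset.inE => ? ->.
move=> jc; have /finset.imsetP[i _ jE] := cT j jc.
by exists i => //; rewrite finset.inE -jE.
Qed.

Lemma incl_excl_cofinal f I J (y : I -> Y) (w : J -> Y) :
  (forall i, exists j, y i <= w j) -> (forall j, exists i, w j <= y i) ->
  incl_excl f y = incl_excl f w.
Proof.
move=> yw wy; pose v (k : I + J) := match k with inl i => y i | inr j => w j end.
have inl_inj' : injective (@inl I J) by move=> ? ? [].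
have inr_inj' : injective (@inr I J) by move=> ? ? [].
rewrite -[LHS](incl_excl_in_imset f v inl_inj').
rewrite -[RHS](incl_excl_in_imset f v inr_inj').
transitivity (incl_excl_in f v [set: I + J]%SET); [symmetry|];
  apply: incl_excl_in_sub; rewrite ?finset.subsetT//.
- move=> [i|j] _; first by exists (inl i) => //; rewrite finset.imset_f.
  by have [i wji] := wy j; exists (inl i) => //; rewrite finset.imset_f.
- move=> [i|j] _; last by exists (inr j) => //; rewrite finset.imset_f.
  by have [j yij] := yw i; exists (inr j) => //; rewrite finset.imset_f.
Qed.

End InclusionExclusion.

Section CanonicalSpace.
Context (d : Order.disp_t) (Y : meetSemilatticeType d).
Implicit Types (s t : seq Y).

Definition seq_le s t : bool := all (fun x => has (fun z => x <= z) t) s.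

Definition seq_equiv s t : bool := seq_le s t && seq_le t s.

Lemma seq_leP s t :
  reflect {in s, forall x, exists2 z, z \in t & x <= z} (seq_le s t).
Proof. by apply: (iffP allP) => h x /h /hasP. Qed.

Lemma seq_le_refl s : seq_le s s.
Proof. by apply/seq_leP => x xs; exists x. Qed.

Lemma seq_le_trans s t r : seq_le s t -> seq_le t r -> seq_le s r.
Proof.
move=> /seq_leP st /seq_leP tr; apply/seq_leP => x /st[z /tr[w wr zw] xz].
by exists w => //; exact: le_trans zw.
Qed.

Lemma seq_equiv_refl : reflexive seq_equiv.
Proof. by move=> s; rewrite /seq_equiv seq_le_refl. Qed.

Lemma seq_equiv_sym : symmetric seq_equiv.
Proof. by move=> s t; rewrite /seq_equiv andbC. Qed.

Lemma seq_equiv_trans : transitive seq_equiv.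
Proof.
move=> t s r /andP[st ts] /andP[tr rt].
by rewrite /seq_equiv (seq_le_trans st tr) (seq_le_trans rt ts).
Qed.

Canonical seq_equiv_rel :=
  EquivRel seq_equiv seq_equiv_refl seq_equiv_sym seq_equiv_trans.

Definition Xi : Type := {eq_quot seq_equiv_rel}%qT.

Definition Xi_class s : Xi := (\pi_({eq_quot seq_equiv_rel}) s)%qT.

Lemma Xi_classP s t : Xi_class s = Xi_class t <-> seq_equiv s t.
Proof. by split => [/eqquotP|h]; [|apply/eqquotP]. Qed.

End CanonicalSpace.


Section CanonicalRepresentation.
Context (d : Order.disp_t) (Y : meetSemilatticeType d) (G : zmodType).

(* Independence of the representative is canonical_repE; it holds for every f,
   modular or not. *)
Definition canonical_rep (f : Y -> G) (xi : Xi Y) : G :=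
  incl_excl f (tnth (in_tuple (repr xi))).

Lemma canonical_repE (f : Y -> G) (s : seq Y) :
  canonical_rep f (Xi_class s) = incl_excl f (tnth (in_tuple s)).
Proof.
have /Xi_classP/andP[h1 h2] : Xi_class (repr (Xi_class s)) = Xi_class s.
  exact: reprK.
have cof (t r : seq Y) : seq_le t r -> forall i : 'I_(size t),
    exists j : 'I_(size r), tnth (in_tuple t) i <= tnth (in_tuple r) j.
  move=> /seq_leP tr i; have [z] := tr _ (mem_tnth i (in_tuple t)).
  by move=> /(tnthP (in_tuple r))[j ->]; exists j.
by apply: incl_excl_cofinal; exact: cof.
Qed.

End CanonicalRepresentation.

Section MeetClosed.
Context (d : Order.disp_t) (L : latticeType d).

Definition meet_closed (X : set L) : Prop :=
  forall x y, X x -> X y -> X (x `&` y).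

Definition join_closed (X : set L) : Prop :=
  forall x y, X x -> X y -> X (x `|` y).

(* X as a meet-semilattice for the order and the meet induced by L; the
   parameter hX is what the semilattice instance below is built from. *)
Definition semilat (X : set L) (hX : meet_closed X) : Type := set_type X.

Section Instances.
Context (X : set L) (hX : meet_closed X).

HB.instance Definition _ := SubType.on (semilat hX).
HB.instance Definition _ := Choice.on (semilat hX).
HB.instance Definition _ := [SubChoice_isSubPOrder of semilat hX by <: with d].

Fact semilat_meet_subproof (x y : semilat hX) : (\val x `&` \val y) \in X.
Proof. by rewrite inE; apply: hX; [have := valP x|have := valP y]; rewrite inE. Qed.

Definition semilat_meet (x y : semilat hX) : semilat hX :=
  Sub (\val x `&` \val y) (semilat_meet_subproof x y).

Fact semilat_lexI (x y z : semilat hX) :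
  (x <= semilat_meet y z) = (x <= y) && (x <= z).
Proof. by rewrite -!Order.le_val SubK lexI. Qed.

HB.instance Definition _ :=
  Order.POrder_isMeetSemilattice.Build d (semilat hX) semilat_lexI.

End Instances.

Definition sublattice (A : set L) : Prop := meet_closed A /\ join_closed A.

Definition gen_lattice (X : set L) : set L := smallest sublattice X.

Lemma gen_lattice_sublattice (X : set L) : sublattice (gen_lattice X).
Proof.
by split=> x y hx hy A hA; have [[Am Aj] _] := hA;
  [apply: Am|apply: Aj]; (exact: hx || exact: hy).
Qed.

Lemma gen_lattice_meet (X : set L) : meet_closed (gen_lattice X).
Proof. by have [] := gen_lattice_sublattice X. Qed.

Definition gen_semilat (X : set L) : Type := semilat (@gen_lattice_meet X).

HB.instance Definition _ (X : set L) :=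
  Order.MeetSemilattice.on (gen_semilat X).
HB.instance Definition _ (X : set L) := SubType.on (gen_semilat X).

Fact gen_incl_subproof (X : set L) (hX : meet_closed X) (x : semilat hX) :
  \val x \in gen_lattice X.
Proof. by rewrite inE; apply: sub_gen_smallest; have := valP x; rewrite inE. Qed.

Definition gen_incl (X : set L) (hX : meet_closed X) (x : semilat hX) :
  gen_semilat X := Sub (\val x) (gen_incl_subproof x).

Definition is_extension (G : Type) (X : set L) (hX : meet_closed X)
    (f : semilat hX -> G) (g : gen_semilat X -> G) : Prop :=
  forall x, g (gen_incl x) = f x.

End MeetClosed.

(* In a distributive lattice, the smallest sublattice containing a meet-closed
   X consists of the suprema of nonempty finite families of elements of X. *)
Lemma gen_latticeP (d : Order.disp_t) (L : distrLatticeType d) (X : set L)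
    (hX : meet_closed X) (u : L) :
  gen_lattice X u <->
  exists s : seq L,
    [/\ s != [::], {in s, forall x, X x} & supremums [set` s] u].
Proof.
split.
  pose J : set L := fun u => forall C : set L, X `<=` C -> join_closed C -> C u.
  move=> /(_ J) Ju; have {Ju} : J u.
    apply: Ju; split; last by move=> x Xx C XC _; exact: XC.
    split=> [x y Jx Jy C XC Cj|x y Jx Jy C XC Cj]; last first.
      exact: (Cj _ _ (Jx C XC Cj) (Jy C XC Cj)).
    apply: (Jx (fun x => C (x `&` y))) => [{Jx}x Xx|a b Ca Cb]; last first.
      by rewrite /= meetUl; exact: Cj.
    apply: (Jy (fun y => C (x `&` y))) => [z Xz|a b Ca Cb].
      by apply: XC; exact: hX.
    by rewrite /= meetUr; exact: Cj.
  pose K : set L := fun u => exists s : seq L,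
    [/\ s != [::], {in s, forall x, X x} & supremums [set` s] u].
  move=> /(_ K); apply=> [x Xx|x y [s [s0 sX [ubs lbs]]] [t [t0 tX [ubt lbt]]]].
    exists [:: x]; split => //; first by move=> z; rewrite inE => /eqP ->.
    split=> [z|z]; first by rewrite /= inE => /eqP ->.
    by apply; rewrite /= inE.
  exists (s ++ t); split; first by case: (s) s0.
    by move=> z; rewrite mem_cat => /orP[/sX|/tX].
  split=> [z|z zst].
    by rewrite /= mem_cat => /orP[/ubs zx|/ubt zy]; rewrite ?(lexUl _ zx) ?(lexUr _ zy).
  rewrite leUx; apply/andP; split; [apply: lbs|apply: lbt] => w ws;
    by apply: zst; rewrite /= mem_cat ws ?orbT.
case=> -[|x s]; first by case.
move=> [_ sX su] A [[_ Aj] XA].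
have supA : exists2 v, A v & supremums [set` x :: s] v.
  elim: s x sX {su u} => [|y s IHs] x sX.
    exists x; first by apply/XA/sX; rewrite inE.
    split=> [z|z]; first by rewrite /= inE => /eqP ->.
    by apply; rewrite /= inE.
  have [|v Av [ubv lbv]] := IHs y; first by move=> z zs; apply: sX; rewrite inE zs orbT.
  exists (x `|` v); first by apply: Aj => //; apply/XA/sX; rewrite inE eqxx.
  split=> [z|z zst].
    rewrite /= inE => /predU1P[->|/ubv zv]; first exact: leUl.
    by rewrite (lexUr _ zv).
  rewrite leUx zst /= ?inE ?eqxx//; apply: lbv => w ws.
  by apply: zst; rewrite /= inE; move: ws => /= ->; rewrite orbT.
by case: supA => v Av /is_subset1_supremums/(_ su) <-.
Qed.

(* Main.v *)
(* Inclusion-exclusion obeys T_f(x :: s) = f(x) + T_h(s) with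
   h(w) = f(w) - f(x /\ w), so T_f can be handled by induction on lists with f
   varying.  This gives T_f(s ++ t) = T_f(s) + T_h(t) with
   h(w) = f(w) - T_f(w /\ s).  If f is modular and w lies below the supremum of
   s in L, then by distributivity w is the supremum of w /\ s, so h(w) = 0:
   hence T_f(s) depends only on the supremum of s in L, which defines g.
   The same formula yields T_f(s ++ t) + T_f(s /\ t) = T_f(s) + T_f(t), that is
   g(u \/ v) + g(u /\ v) = g(u) + g(v), and full modularity follows. *)
Require Import Defs.
From mathcomp Require Import all_boot all_order all_algebra.
From mathcomp Require Import boolp classical_sets.

Import Order.TTheory GRing.Theory.
(* Order.TTheory also exports a [meet_closed], which must stay shadowed. *)
Import Defs.

Local Open Scope classical_set_scope.

Set Implicit Arguments.
Unset Strict Implicit.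
Unset Printing Implicit Defensive.

(** * Inclusion-exclusion as a recursion on lists *)

Section SeqInclusionExclusion.
Context (d : Order.disp_t) (Y : meetSemilatticeType d) (G : zmodType).
Implicit Types (f h : Y -> G) (s t : seq Y) (x w : Y).

Definition meet_diff f x w : G := (f w - f (Order.meet x w))%R.

Fixpoint seq_incl_excl f s : G :=
  if s is x :: s' then (f x + seq_incl_excl (meet_diff f x) s')%R else 0%R.

(** The recursion evaluates the function only at elements below some member of the list. This serves
    to change the function inside the recursion where two functions agree only locally. *)
Lemma seq_incl_excl_local f h s :
  (forall w x, x \in s -> (w <= x)%O -> f w = h w) ->
  seq_incl_excl f s = seq_incl_excl h s.
Proof.
elim: s f h => //= x s IHs f h fh; rewrite (fh x x) ?mem_head//.
congr (_ + _)%R; apply: IHs => w z zs wz; rewrite /meet_diff.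
by rewrite (fh w z) ?inE ?zs ?orbT// (fh _ x) ?mem_head// leIl.
Qed.

Lemma seq_incl_exclB f h s :
  seq_incl_excl (fun w => f w - h w)%R s =
  (seq_incl_excl f s - seq_incl_excl h s)%R.
Proof.
elim: s f h => [|x s IHs] f h /=; first by rewrite subr0.
rewrite opprD addrACA -IHs; congr (_ + _)%R; apply: seq_incl_excl_local => w _ _ _.
by rewrite /meet_diff !opprD addrACA.
Qed.

Lemma seq_incl_excl0 s : seq_incl_excl (fun=> 0%R) s = 0%R.
Proof.
elim: s => //= x s IHs; rewrite add0r -[RHS]IHs.
by apply: seq_incl_excl_local => w _ _ _; rewrite /meet_diff subrr.
Qed.

Lemma seq_incl_excl_meet f x s :
  seq_incl_excl f [seq Order.meet x z | z <- s] =
  seq_incl_excl (fun w => f (Order.meet x w)) s.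
Proof.
elim: s f => //= z s IHs f; rewrite IHs; congr (_ + _)%R.
by apply: seq_incl_excl_local => w _ _ _; rewrite /meet_diff meetACA meetxx.
Qed.

Lemma seq_incl_excl_cat f s t :
  seq_incl_excl f (s ++ t) =
  (seq_incl_excl f s +
   seq_incl_excl
     (fun w => f w - seq_incl_excl f [seq Order.meet w z | z <- s]) t)%R.
Proof.
elim: s f => [|x s IHs] f /=.
  by rewrite add0r; apply: seq_incl_excl_local => w _ _ _; rewrite subr0.
rewrite IHs addrA; congr (_ + _)%R; apply: seq_incl_excl_local => w _ _ _.
rewrite opprD addrA [Order.meet w x]meetC; congr (_ - _)%R.
(* For [v] below [w], the meets of [v] with [x] and with [x /\ w] coincide. *)
apply: seq_incl_excl_local => v _ /mapP[z _ ->]; rewrite lexI => /andP[vw _].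
by rewrite /meet_diff -meetA (meet_r vw).
Qed.

(** * Agreement with the sum over subsets *)

Lemma f_meetU1 f (I : finType) (y : I -> Y) (b : {set I}) (j : I) :
  b != finset.set0 ->
  f_meet f y (j |: b)%SET = f_meet (fun w => f (Order.meet (y j) w)) y b.
Proof.
move=> /finset.set0Pn[i ib]; rewrite /f_meet.
case: pickP => [i0 i0b|/(_ j)]; last by rewrite !inE eqxx.
case: pickP => [j0 j0b|/(_ i)]; last by rewrite ib.
congr f; apply/eqP/eq_geP => z; rewrite lexI !le_bigmeet//.
apply/forall_inP/andP => [h|[zj /forall_inP h] n].
  split; first by apply: h; rewrite !inE eqxx.
  by apply/forall_inP => n nb; apply: h; rewrite !inE nb orbT.
by rewrite !inE => /predU1P[->|/h].
Qed.

(** The subsets containing [j] are the [j |: b] with [b] inside [A]. The empty [b] gives [f (y j)];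
    for nonempty [b] the sign is opposite to [nu b], and the term merges with that of [b] itself
    into a [meet_diff] term. *)
Lemma incl_excl_inU1 f (I : finType) (y : I -> Y) (A : {set I}) (j : I) :
  j \notin A ->
  incl_excl_in f y (j |: A)%SET =
  (f (y j) + incl_excl_in (meet_diff f (y j)) y A)%R.
Proof.
move=> jA; have subA (b : {set I}) : j \in b = false ->
    (b \subset (j |: A)%SET) = (b \subset A).
  move=> jb; apply/idP/idP => [bA|/fintype.subset_trans]; last first.
    by apply; exact: finset.subsetUr.
  by rewrite -(finset.setU1K jA) finset.subsetD1 bA jb.
have jU (b : {set I}) : j \in (j |: b)%SET by rewrite !inE eqxx.
rewrite /incl_excl_in (bigID (fun b : {set I} => j \in b)) /=.
rewrite (reindex_onto (fun b => j |: b)%SET (fun b => b :\ j)%SET) /=; last first.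
  by move=> b /andP[_ jb]; rewrite finset.setD1K.
rewrite (eq_bigl (fun b : {set I} => b \subset A)); last first.
  move=> b; rewrite jU andbT; have -> : (j |: b)%SET != finset.set0.
    by apply/finset.set0Pn; exists j.
  case jb: (j \in b); last first.
    rewrite finset.setU1K ?jb// eqxx andbT finset.subUset finset.sub1set jU /=.
    exact: subA.
  have -> : ((j |: b) :\ j == b)%SET = false.
    by apply/eqP => bE; move: jb; rewrite -bE !inE eqxx.
  rewrite andbF; apply/esym/negbTE/negP => /fintype.subsetP/(_ _ jb).
  exact/negP.
rewrite (bigD1 finset.set0) ?finset.sub0set//= finset.setU0 -addrA; congr (_ + _)%R.
  have -> : nu [set j]%SET = 1%R by rewrite /nu finset.cards1.
  rewrite mulr1z /f_meet; case: pickP => [n|/(_ j)]; last by rewrite !inE eqxx.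
  by rewrite !inE => /eqP ->; congr f; rewrite big_set1E /= meetxx.
rewrite addrC (eq_bigl (fun b => (b != finset.set0) && (b \subset A))); last first.
  move=> b; case jb: (j \in b); last by rewrite subA// andbT.
  rewrite andbF; apply/esym/negbTE; rewrite negb_and; apply/orP; right.
  by apply/negP => /fintype.subsetP/(_ _ jb); exact/negP.
rewrite [X in (_ + X)%R](eq_bigl (fun b => (b != finset.set0) && (b \subset A)));
  last by move=> b; rewrite andbC.
rewrite -big_split; apply: eq_bigr => b /andP[b0 bA] /=.
have jb : j \notin b by apply: contra jA => /(fintype.subsetP bA).
have -> : nu (j |: b)%SET = (- nu b)%R.
  by rewrite /nu finset.cardsU1 jb [LHS]exprS mulN1r.
rewrite f_meetU1// mulrNz -mulrzBl; congr (_ *~ _)%R; rewrite /f_meet.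
by case: pickP => // _; rewrite subrr.
Qed.

Lemma incl_exclE f (I : finType) (y : I -> Y) :
  incl_excl f y = seq_incl_excl f [seq y i | i <- enum I].
Proof.
have -> : incl_excl f y = incl_excl_in f y [set i in enum I]%SET.
  apply: eq_bigl => b; rewrite (_ : (b \subset _) = true) ?andbT//.
  by apply/fintype.subsetP => i _; rewrite inE mem_enum.
(* Generalised to any duplicate-free list, whose head is then outside the set of the remaining
   entries. *)
elim: (enum I) (enum_uniq I) f => [_ f|j r IHr /= /andP[jr ur] f].
  rewrite /incl_excl_in big_pred0// => b; rewrite finset.set_nil finset.subset0.
  by rewrite andNb.
by rewrite finset.set_cons incl_excl_inU1 ?inE// IHr.
Qed.

Lemma incl_excl_tnth f s :
  incl_excl f (tnth (in_tuple s)) = seq_incl_excl f s.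
Proof.
by rewrite incl_exclE; congr seq_incl_excl; rewrite -[RHS](map_tnth_enum (in_tuple s)).
Qed.

(** * Equivalent lists and pairwise meets *)

Lemma seq_incl_excl_equiv f s t :
  seq_equiv s t -> seq_incl_excl f s = seq_incl_excl f t.
Proof. by rewrite -!incl_excl_tnth -!canonical_repE => /Xi_classP ->. Qed.

(** Induction on [t]: by the concatenation formula, the block of meets with the head [z] turns [f]
    into [meet_diff f z] below the remaining entries. *)
Lemma seq_incl_excl_allpairs f s t :
  seq_incl_excl f [seq Order.meet z x | z <- t, x <- s] =
  seq_incl_excl (fun w => seq_incl_excl f [seq Order.meet w x | x <- s]) t.
Proof.
elim: t f => //= z t IHt f; rewrite seq_incl_excl_cat; congr (_ + _)%R.
transitivity (seq_incl_excl (meet_diff f z) [seq Order.meet z x | z <- t, x <- s]).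
  apply: seq_incl_excl_local => w _ /allpairsP[[z' x] /= [_ xs ->]].
  rewrite lexI => /andP[_ wx]; rewrite /meet_diff; congr (_ - _)%R.
  (* As [w] lies below the entry [x] of [s], its meets with the block reduce, up to equivalence, to
     the single element [z /\ w]. *)
  rewrite -map_comp (@seq_incl_excl_equiv _ _ [:: Order.meet z w]) /= ?addr0//.
  apply/andP; split; apply/seq_leP => v.
    move=> /mapP[x' _ ->]; exists (Order.meet z w); rewrite ?mem_head//=.
    by rewrite meetCA meetA leIl.
  rewrite inE => /eqP ->; exists (Order.meet w (Order.meet z x)).
    by apply/mapP; exists x.
  by rewrite meetCA (meet_l wx).
rewrite IHt; apply: seq_incl_excl_local => w _ _ _.
rewrite seq_incl_exclB -seq_incl_excl_meet -map_comp; congr (_ - seq_incl_excl _ _)%R.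
by apply: eq_map => x /=; rewrite meetA.
Qed.

Lemma seq_incl_excl_catD f s t :
  (seq_incl_excl f (s ++ t) +
   seq_incl_excl f [seq Order.meet z x | z <- t, x <- s])%R =
  (seq_incl_excl f s + seq_incl_excl f t)%R.
Proof.
by rewrite seq_incl_excl_cat seq_incl_exclB seq_incl_excl_allpairs addrA addrNK.
Qed.

End SeqInclusionExclusion.

(** * Modularity in terms of lists *)

Section ModularSeq.
Context (d : Order.disp_t).

(** A Boolean equation on upper bounds, so that a supremum can be used by rewriting. *)
Definition is_lub (P : porderType d) (s : seq P) (u : P) : Prop :=
  forall z, (u <= z)%O = all (fun x => x <= z)%O s.

Lemma is_lub_range (P : porderType d) (I : finType) (y : I -> P) (u : P) :
  supremums (range y) u <-> is_lub [seq y i | i <- enum I] u.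
Proof.
split=> [[yu uy] z|yu].
  rewrite all_map; apply/idP/allP => [uz i _|yz].
    by rewrite /= (le_trans _ uz)//; apply: yu; exists i.
  by apply: uy => _ [i _ <-]; apply: yz; rewrite mem_enum.
split=> [_ [i _ <-]|z yz].
  have := lexx u; rewrite yu all_map => /allP/(_ i); apply.
  by rewrite mem_enum.
by rewrite yu all_map; apply/allP => i _; apply: yz; exists i.
Qed.

Lemma is_lub_uniq (P : porderType d) (s : seq P) (u v : P) :
  is_lub s u -> is_lub s v -> u = v.
Proof.
by move=> su sv; apply/le_anti; rewrite su -sv lexx /= sv -su lexx.
Qed.

Lemma is_lub_ub (P : porderType d) (s : seq P) (u x : P) :
  is_lub s u -> x \in s -> (x <= u)%O.
Proof. by move=> su; have := lexx u; rewrite su => /allP/(_ x). Qed.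

Lemma modularP (Y : meetSemilatticeType d) (G : zmodType) (g : Y -> G) :
  modular g <->
  (forall (s : seq Y) (u : Y), s != [::] -> is_lub s u -> g u = seq_incl_excl g s).
Proof.
split=> [gm s u s0 su|gm N y u N0 /is_lub_range yu].
  rewrite -incl_excl_tnth; apply: gm; first by case: (s) s0.
  by apply/is_lub_range; rewrite (map_tnth_enum (in_tuple s)).
rewrite incl_exclE; apply: gm => //.
by rewrite -size_eq0 size_map size_enum_ord -lt0n.
Qed.

(** Joins are not part of the structure of [Y], so their existence and distributivity are expressed
    by [is_lub]. Induction on the list with [g] varying: [meet_diff g x] inherits the valuation
    identity because meets with [x] preserve binary joins. *)
Lemma valuation_modular (Y : meetSemilatticeType d) (G : zmodType) (g : Y -> G) :
  (forall a b : Y, exists c, is_lub [:: a; b] c) ->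
  (forall w a b c : Y, is_lub [:: a; b] c ->
     is_lub [:: Order.meet w a; Order.meet w b] (Order.meet w c)) ->
  (forall a b c : Y, is_lub [:: a; b] c -> g c = (g a + g b - g (Order.meet a b))%R) ->
  modular g.
Proof.
move=> Yex Ydistr gval; apply/modularP => -[//|x s] u _.
elim: s x u g gval => [|y s IHs] x u g gval su.
  rewrite /= addr0; congr g; apply: (is_lub_uniq su) => z.
  by rewrite /= andbT.
have [v sv] : exists v, is_lub (y :: s) v.
  elim: s y {IHs su} => [|z s IHs] y; first by exists y => z; rewrite /= andbT.
  have [v sv] := IHs z; have [w yvw] := Yex y v.
  by exists w => t; rewrite yvw /= andbT sv.
have -> : seq_incl_excl g [:: x, y & s] =
    (g x + seq_incl_excl (meet_diff g x) (y :: s))%R by [].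
rewrite -(IHs y v _ _ sv).
  rewrite addrA; apply: gval => z; rewrite su /= andbT; congr (_ && _).
  by rewrite sv.
move=> a b c abc; rewrite /meet_diff (gval _ _ _ abc) (gval _ _ _ (Ydistr x _ _ _ abc)).
by rewrite meetACA meetxx !opprD !opprK addrACA [X in (X + _)%R]addrACA.
Qed.

Lemma is_lub_meet (L : distrLatticeType d) (w u : L) (s : seq L) :
  s != [::] -> is_lub s u -> is_lub [seq Order.meet w x | x <- s] (Order.meet w u).
Proof.
case: s => [//|x s _]; elim: s x u => [|y s IHs] x u su.
  have -> : u = x by apply: is_lub_uniq su _ => z; rewrite /= andbT.
  by move=> z; rewrite /= andbT.
have [v sv] : exists v, is_lub (y :: s) v.
  elim: s y {IHs su} => [|z s IHs] y; first by exists y => z; rewrite /= andbT.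
  have [v sv] := IHs z; exists (Order.join y v) => t.
  by rewrite leUx sv.
have -> : u = Order.join x v.
  by apply: is_lub_uniq su _ => z; rewrite leUx sv.
by move=> z; rewrite meetUr leUx (IHs y v sv).
Qed.

End ModularSeq.

(** * Dependence on the supremum in [L] only *)

Section Extension.
Context (d : Order.disp_t) (L : distrLatticeType d) (G : zmodType).
Context (X : set L) (hX : meet_closed X) (f : semilat hX -> G).
Hypothesis hf : modular f.
Implicit Types (s t : seq (semilat hX)) (x w : semilat hX).

Let Tf s := seq_incl_excl f s.

Lemma val_meet (A : set L) (hA : meet_closed A) (a b : semilat hA) :
  \val (Order.meet a b) = Order.meet (\val a) (\val b).
Proof. by []. Qed.

(** The order on [A] is induced, so a supremum in [L] that lies in [A] is one in [A]. The converse
    may fail. *)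
Lemma is_lub_val (A : set L) (hA : meet_closed A) (r : seq (semilat hA)) u :
  is_lub [seq \val y | y <- r] (\val u) -> is_lub r u.
Proof. by move=> ru z; rewrite -Order.le_val ru all_map. Qed.

Lemma seq_incl_excl_absorb s t (u : L) : t != [::] ->
  is_lub [seq \val x | x <- t] u -> (forall x, x \in s -> \val x <= u)%O ->
  Tf (t ++ s) = Tf t.
Proof.
move=> t0 tu su; rewrite /Tf seq_incl_excl_cat -[RHS]addr0; congr (_ + _)%R.
rewrite -[RHS](seq_incl_excl0 G s); apply: seq_incl_excl_local => w x xs wx.
apply/eqP; rewrite subr_eq0; apply/eqP; apply: (modularP _).1 => //.
  by rewrite -size_eq0 size_map size_eq0.
apply: is_lub_val; rewrite -map_comp.
(* Since [w] is below [u], distributivity makes it the supremum of its meets with [t]. *)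
have -> : \val w = Order.meet (\val w) u.
  by apply/esym/meet_l/(le_trans _ (su x xs)); rewrite Order.le_val.
have := is_lub_meet (\val w) _ tu.
rewrite -map_comp; apply.
by rewrite -size_eq0 size_map size_eq0.
Qed.

(** Each list absorbs the other, and [s ++ t] and [t ++ s] are equivalent. *)
Lemma seq_incl_excl_lub s t (u : L) : s != [::] -> t != [::] ->
  is_lub [seq \val x | x <- s] u -> is_lub [seq \val x | x <- t] u -> Tf s = Tf t.
Proof.
move=> s0 t0 su tu; rewrite -(@seq_incl_excl_absorb t s u)//; last first.
  by move=> x xt; apply: (is_lub_ub tu); exact: map_f.
rewrite -(@seq_incl_excl_absorb s t u)//; last first.
  by move=> x xs; apply: (is_lub_ub su); exact: map_f.
apply: seq_incl_excl_equiv; apply/andP; split; apply/seq_leP => x;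
  by rewrite mem_cat => xst; exists x; rewrite // mem_cat orbC.
Qed.

(** * Construction of the extension *)

Lemma gen_semilat_lub (u : gen_semilat X) :
  exists s, s != [::] /\ is_lub [seq \val x | x <- s] (\val u).
Proof.
have : gen_lattice X (\val u) by have := valP u; rewrite inE.
move=> /(gen_latticeP hX)[r [r0 rX [ru ur]]].
have [s sr] : exists s, [seq \val x | x <- s] = r.
  elim: r rX {r0 ru ur} => [|a r IHr] rX; first by exists [::].
  have [|s <-] := IHr; first by move=> x xr; apply: rX; rewrite inE xr orbT.
  have aX : a \in X by rewrite inE; apply: rX; rewrite mem_head.
  by exists (Sub a aX :: s).
exists s; split; first by move: r0; rewrite -sr; case: (s).
rewrite sr => z; apply/idP/allP => [uz x xr|rz].
  by rewrite (le_trans _ uz)//; exact: ru.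
by apply: ur => x; exact: rz.
Qed.

(** The list is an arbitrary choice; [extensionE] shows that the value of [extension] does not
    depend on it. *)
Definition lub_seq u := sval (cid (gen_semilat_lub u)).

Lemma lub_seq_neq0 u : lub_seq u != [::].
Proof. by rewrite /lub_seq; case: cid => s []. Qed.

Lemma lub_seqP u : is_lub [seq \val x | x <- lub_seq u] (\val u).
Proof. by rewrite /lub_seq; case: cid => s []. Qed.

Definition extension (u : gen_semilat X) : G := Tf (lub_seq u).

Lemma extensionE s u : s != [::] ->
  is_lub [seq \val x | x <- s] (\val u) -> extension u = Tf s.
Proof.
by move=> s0 su; apply: (seq_incl_excl_lub _ s0 (lub_seqP u) su);
  exact: lub_seq_neq0.
Qed.

Lemma is_extension_extension : is_extension f extension.
Proof.
move=> x; rewrite (@extensionE [:: x])// /Tf /= ?addr0//.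
by move=> z; rewrite /= andbT.
Qed.

(** * Modularity of the extension *)

Fact gen_join_subproof (a b : gen_semilat X) :
  Order.join (\val a) (\val b) \in gen_lattice X.
Proof.
rewrite inE; apply: (gen_lattice_sublattice X).2.
  by have := valP a; rewrite inE.
by have := valP b; rewrite inE.
Qed.

Definition gen_join (a b : gen_semilat X) : gen_semilat X :=
  Sub (Order.join (\val a) (\val b)) (gen_join_subproof a b).

(** The sublattice is closed under joins, so here suprema of pairs agree with those of [L]. *)
Lemma gen_semilat_lub2 (a b c : gen_semilat X) :
  is_lub [:: a; b] c <-> \val c = Order.join (\val a) (\val b).
Proof.
split=> [abc|cE]; last first.
  by apply: is_lub_val => z; rewrite cE leUx /= andbT.
rewrite (_ : c = gen_join a b)//; apply: (is_lub_uniq abc).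
by apply: is_lub_val => z; rewrite leUx /= andbT.
Qed.

Lemma is_lub_cat s t (u v : L) :
  is_lub [seq \val x | x <- s] u -> is_lub [seq \val x | x <- t] v ->
  is_lub [seq \val x | x <- s ++ t] (Order.join u v).
Proof. by move=> su tv z; rewrite leUx su tv map_cat all_cat. Qed.

(** Distributivity is used twice: [u /\ v] is the supremum of the [u /\ y] for [y] in [t], and each
    of these is the supremum of the meets of [y] with the entries of [s]. *)
Lemma is_lub_allpairs s t (u v : L) : s != [::] -> t != [::] ->
  is_lub [seq \val x | x <- s] u -> is_lub [seq \val x | x <- t] v ->
  is_lub [seq \val x | x <- [seq Order.meet z x | z <- t, x <- s]] (Order.meet u v).
Proof.
move=> s0 t0 su tv z; have -> r : all (fun a => a <= z)%O
      [seq \val x | x <- [seq Order.meet y x | y <- r, x <- s]] =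
    all (fun y => all (fun x => \val (Order.meet y x) <= z)%O s) r.
  by elim: r => //= y r IHr; rewrite map_cat all_cat IHr !all_map.
rewrite (is_lub_meet u _ tv); last by rewrite -size_eq0 size_map size_eq0.
rewrite !all_map; apply: eq_all => x /=.
rewrite meetC (is_lub_meet (\val x) _ su) ?all_map//.
by rewrite -size_eq0 size_map size_eq0.
Qed.

Lemma modular_extension : modular extension.
Proof.
apply: valuation_modular => [a b|w a b c|a b c].
- by exists (gen_join a b); apply/gen_semilat_lub2.
- move=> /gen_semilat_lub2 cE; apply/gen_semilat_lub2.
  by rewrite !val_meet cE meetUr.
move=> /gen_semilat_lub2 cE.
have [a0 b0] := (lub_seq_neq0 a, lub_seq_neq0 b).
have [aP bP] := (lub_seqP a, lub_seqP b).
(* The join is represented by the concatenation of the chosen lists, the meet by their pairwise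
   meets. *)
rewrite (@extensionE (lub_seq a ++ lub_seq b) c); last by rewrite cE; exact: is_lub_cat.
  rewrite (@extensionE [seq Order.meet z x | z <- lub_seq b, x <- lub_seq a]
             (Order.meet a b)).
  - by rewrite /extension /Tf -seq_incl_excl_catD addrK.
  - by case: (lub_seq a) (lub_seq b) a0 b0 => [|? ?] [|? ?].
  exact: is_lub_allpairs.
by case: (lub_seq a) a0.
Qed.

(** * Uniqueness and the explicit formula *)

Lemma seq_incl_excl_gen_incl (g : gen_semilat X -> G) s :
  seq_incl_excl g [seq gen_incl x | x <- s] =
  seq_incl_excl (fun x => g (gen_incl x)) s.
Proof.
elim: s g => //= x s IHs g; rewrite IHs; congr (_ + _)%R.
apply: seq_incl_excl_local => w _ _ _; rewrite /meet_diff.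
by congr (_ - g _)%R; exact: val_inj.
Qed.

(** Modularity of [g] expresses [g u] by values on [X] alone, where [g] is [f]. Both uniqueness and
    the formula follow. *)
Lemma modular_is_extensionE (g : gen_semilat X -> G) s u :
  modular g -> is_extension f g -> s != [::] ->
  is_lub [seq \val x | x <- s] (\val u) -> g u = Tf s.
Proof.
move=> gm gf s0 su; transitivity (seq_incl_excl g [seq gen_incl x | x <- s]).
  apply: (modularP _).1 => //; first by rewrite -size_eq0 size_map size_eq0.
  by apply: is_lub_val; rewrite -map_comp; exact: su.
rewrite seq_incl_excl_gen_incl; apply: seq_incl_excl_local => w _ _ _.
exact: gf.
Qed.

End Extension.

Theorem theorem3 (d : Order.disp_t) (L : distrLatticeType d) (G : zmodType)
    (X : set L) (hX : meet_closed X) (f : semilat hX -> G) (hf : modular f) :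
  (exists! g : gen_semilat X -> G, modular g /\ is_extension f g) /\
  (forall g : gen_semilat X -> G, modular g -> is_extension f g ->
     forall (N : nat) (x : 'I_N -> semilat hX) (u : L), (0 < N)%N ->
       supremums (range (fun n => \val (x n))) u ->
       exists2 v : gen_semilat X,
         \val v = u
         & g v = canonical_rep f (Xi_class [seq x n | n <- enum 'I_N])).
Proof.
split.
  exists (@extension _ _ _ _ hX f); split.
    by split; [exact: modular_extension|exact: is_extension_extension].
  (* On the list chosen for [u], the value forced on [g] is [extension u] by definition. *)
  move=> g [gm gf]; apply: funext => u.
  rewrite (modular_is_extensionE (s := lub_seq hX u) gm gf)//.
    exact: lub_seq_neq0.
  exact: lub_seqP.
move=> g gm gf N x u N0 /is_lub_range xu.
have s0 : [seq x n | n <- enum 'I_N] != [::].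
  by rewrite -size_eq0 size_map size_enum_ord -lt0n.
(* A supremum in [L] of a nonempty finite family from [X] lies in the generated sublattice; this
   provides the witness [v]. *)
have uX : u \in gen_lattice X.
  rewrite inE; apply/(gen_latticeP hX).
  exists [seq \val (x n) | n <- enum 'I_N]; split.
  - by rewrite -size_eq0 size_map size_enum_ord -lt0n.
  - by move=> _ /mapP[n _ ->]; have := valP (x n); rewrite inE.
  split=> [z zx|z xz]; first exact: is_lub_ub xu zx.
  by rewrite xu; apply/allP => y; exact: xz.
exists (Sub u uX); first by rewrite SubK.
rewrite canonical_repE incl_excl_tnth.
by apply: modular_is_extensionE => //; rewrite SubK -map_comp.
Qed.
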